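(* Let $\gamma\in\mathbb{R}$ be a real constant, and let $u,v,w,z:I\to\mathbb{R}$ be arbitrary solutions of the second-order linear differential equation $F''=\gamma F$ such that $v>0$ and $z>0$ hold on $I$ and $\{u,v\}$ and $\{w,z\}$ are linearly independent. Assume that the functions $f,g:I\to\mathbb{R}$, $p=(p_1,p_2):I\to\mathbb{R}_+^2$, and $q=(q_1,q_2):I\to\mathbb{R}_+^2$ satisfy $$f=\frac{u}{v},\qquad g=\frac{w}{z},\qquad\text{and}\qquad p_1q_1=p_2q_2=vz$$ on $I$. Then $f$ and $g$ are strictly monotone and continuous, and the invariance equation $$A_{f,p}(x,y)+A_{g,q}(x,y)=x+y$$ holds for all $x,y\in I$.
   Context: $I$ denotes a nonempty open real interval, and $\mathbb{R}_+$ denotes the set of positive real numbers. For a continuous strictly monotone function $f:I\to\mathbb{R}$ and a pair of positive functions $p=(p_1,p_2):I\to\mathbb{R}_+^2$, the two-variable generalized Bajraktarević mean $A_{f,p}:I^2\to I$ is defined by $$A_{f,p}(x,y):=f^{-1}\left(\frac{p_1(x)f(x)+p_2(y)f(y)}{p_1(x)+p_2(y)}\right)\qquad(x,y\in I).$$ $A_{g,q}$ is defined analogously from $g$ and $q$. *)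

(* Defs.v *)
From HB Require Import structures.
From mathcomp Require Import all_boot all_order all_algebra.
From mathcomp Require Import all_classical all_reals all_analysis.

Set Implicit Arguments.
Unset Strict Implicit.
Unset Printing Implicit Defensive.

Import Order.TTheory GRing.Theory Num.Theory.
Import numFieldNormedType.Exports.

Local Open Scope classical_set_scope.
Local Open Scope ring_scope.

(* A function on I is represented by a total function R -> R of which only the
   values on I matter.  The derivatives below are taken at points of I only, so
   they depend only on the values on I as soon as I is open. *)

Definition open_interval (R : realType) (I : set R) : Prop :=
  [/\ is_interval I, open I & I !=set0].

Definition solves (R : realType) (I : set R) (gamma : R) (F : R -> R) : Prop :=
  forall x, I x ->
    [/\ derivable F x 1, derivable (derive1 F) x 1 &
        derive1 (derive1 F) x = gamma * F x].

Definition lin_indep_on (R : realType) (I : set R) (u v : R -> R) : Prop :=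
  forall a b : R, (forall x, I x -> a * u x + b * v x = 0) -> a = 0 /\ b = 0.

Definition strictly_monotone_on (R : realType) (I : set R) (f : R -> R) : Prop :=
  {in I &, {homo f : x y / x < y}} \/ {in I &, {homo f : x y /~ x < y}}.

(* The inverse of f : I -> f(I) is the partial inverse of f on I; its default
   value 0 outside f(I) is irrelevant when f is continuous and strictly monotone
   on I and p1, p2 are positive, because the weighted average of f x and f y
   then lies in f(I). *)
Definition bajraktarevic (R : realType) (I : set R) (f p1 p2 : R -> R)
    (x y : R) : R :=
  'pinv_(fun=> 0) I f ((p1 x * f x + p2 y * f y) / (p1 x + p2 y)).

(* Main.v *)
Require Import Defs.
From HB Require Import structures.
From mathcomp Require Import all_boot all_order all_algebra.
From mathcomp Require Import all_classical all_reals all_analysis.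
From mathcomp Require Import ring lra.
Import Order.TTheory GRing.Theory Num.Theory.
Import numFieldNormedType.Exports.
Local Open Scope classical_set_scope.
Local Open Scope ring_scope.

(** The identity behind the invariance is an addition formula.  Let S and C
    solve S' = C, C' = gamma S with S(0) = 0 and C(0) = 1 (sinh and cosh, sin
    and cos, or x and 1, up to scaling, according to the sign of gamma).  Every
    solution of F'' = gamma F is F(x) = F(t) C(x - t) + F'(t) S(x - t)
    ([solves_from_initial_values]).  Hence, writing W for the Wronskian
    u'v - uv', which is constant and nonzero,
      f(x) - f(t) = W S(x - t) / (v(x) v(t))      ([quotient_increment]),
    and the same holds for g with w, z and another constant.  Also
    f' = W / v^2, so f and g are strictly monotone and continuous.

    A value t in I is A_{f,p}(x,y) as soon as
      p1(x) (f(x) - f(t)) + p2(y) (f(y) - f(t)) = 0,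
    and by the intermediate value theorem such a t exists between x and y
    ([balance_point_exists]).  By the increment formula this condition reads
      (p1(x) / v(x)) S(x - t) = (p2(y) / v(y)) S(t - y).
    Put s = x + y - t, again a point of I.  Then x - s = t - y and
    s - y = x - t, and p1 q1 = p2 q2 = v z turns the weights q1 / z, q2 / z into
    the reciprocals v / p1, v / p2, so that the corresponding condition for
    s = A_{g,q}(x,y),
      (v(x) / p1(x)) S(t - y) = (v(y) / p2(y)) S(x - t),
    is the previous one rearranged.  Thus the two means are t and x + y - t. *)

Set Implicit Arguments.
Unset Strict Implicit.
Unset Printing Implicit Defensive.

(** * Functions with a derivative on an interval *)

Lemma mean_value_on (R : realType) (I : set R) (F dF : R -> R) (x y : R) :
  is_interval I -> (forall r : R, I r -> is_derive r 1 F (dF r)) ->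
  I x -> I y -> x < y -> exists2 c, I c & F y - F x = dF c * (y - x).
Proof.
move=> itvI derF Ix Iy xy.
have subI r : r \in `[x, y] -> I r.
  by rewrite in_itv /= => /andP[xr ry]; apply: (itvI x y) => //; rewrite xr ry.
have [||c cxy Fxy] := MVT (f := F) (df := dF) xy.
- by move=> r /subset_itv_oo_cc /subI /derF.
- by apply: derivable_within_continuous => r /subI /derF [].
by exists c => //; apply/subI/subset_itv_oo_cc.
Qed.

Lemma zero_derive_constant_on (R : realType) (I : set R) (F : R -> R) :
  is_interval I -> (forall r : R, I r -> is_derive r 1 F 0) ->
  forall x y, I x -> I y -> F x = F y.
Proof.
move=> itvI derF x y Ix Iy; wlog xy : x y Ix Iy / x < y.
  by move=> wl; case: (ltgtP x y) => [|yx|->] //; [exact: wl|rewrite (wl y x)].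
have [c _ /eqP] := mean_value_on (dF := fun=> 0) itvI derF Ix Iy xy.
by rewrite mul0r subr_eq0 => /eqP.
Qed.

Lemma signed_derive_strictly_monotone_on (R : realType) (I : set R)
    (F dF : R -> R) :
  is_interval I -> (forall r : R, I r -> is_derive r 1 F (dF r)) ->
  (forall r, I r -> 0 < dF r) \/ (forall r, I r -> dF r < 0) ->
  strictly_monotone_on I F.
Proof.
move=> itvI derF [] sgn; [left|right] => x y /set_mem Ix /set_mem Iy xy.
- have [c Ic Fxy] := mean_value_on itvI derF Ix Iy xy.
  by rewrite -subr_gt0 Fxy mulr_gt0 ?sgn ?subr_gt0.
- have [c Ic Fxy] := mean_value_on itvI derF Iy Ix xy.
  by rewrite -subr_lt0 Fxy pmulr_llt0 ?sgn ?subr_gt0.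
Qed.

Lemma is_derive_continuous_on (R : realType) (I : set R) (F dF : R -> R) :
  (forall r : R, I r -> is_derive r 1 F (dF r)) -> {within I, continuous F}.
Proof.
move=> derF; apply: continuous_in_subspaceT => x /set_mem Ix.
by apply/differentiable_continuous/derivable1_diffP; case: (derF x Ix).
Qed.

(** * The equation F'' = gamma F *)

Lemma is_derive_scaled_arg (R : realType) (F : R -> R) (k x dF : R) :
  is_derive (k * x) 1 F dF -> is_derive x 1 (fun r => F (k * r)) (dF * k).
Proof.
move=> dFkx; suff dk : is_derive x 1 (fun r => k * r) k.
  exact: (@is_derive1_comp _ F _ _ _ _ dFkx dk).
have -> : (fun r => k * r) = (k *: id) by apply/funext.
by apply: is_derive_eq; rewrite /GRing.scale /= mulr1.
Qed.

(** The scaling makes C equal to S' in each case, so that the later computations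
    need no distinction on the sign of gamma. *)
Lemma sine_like_solution (R : realType) (gamma : R) :
  exists S C : R -> R, [/\ S 0 = 0, C 0 = 1,
    forall x : R, is_derive x 1 S (C x) &
    forall x : R, is_derive x 1 C (gamma * S x)].
Proof.
case: (ltgtP gamma 0) => [gamma_lt0|gamma_gt0|->].
- pose k := Num.sqrt (- gamma).
  have k0 : k != 0 by rewrite gt_eqF // sqrtr_gt0 oppr_gt0.
  have gammaE : gamma = - k ^+ 2 by rewrite sqr_sqrtr ?opprK // oppr_ge0 ltW.
  exists (k^-1 *: (fun r => sin (k * r))), (fun r => cos (k * r)).
  have dsin (x : R) := is_derive_scaled_arg (is_derive_sin (k * x)).
  have dcos (x : R) := is_derive_scaled_arg (is_derive_cos (k * x)).
  split=> [||x|x].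
  + by rewrite /GRing.scale /= mulr0 sin0 scaler0.
  + by rewrite mulr0 cos0.
  + by apply: is_derive_eq; rewrite /GRing.scale /=; field.
  + by apply: is_derive_eq; rewrite /GRing.scale /= /GRing.scale /= gammaE; field.
- pose k := Num.sqrt gamma.
  have k0 : k != 0 by rewrite gt_eqF // sqrtr_gt0.
  have gammaE : gamma = k ^+ 2 by rewrite sqr_sqrtr // ltW.
  pose e (c : R) r := expR (c * r).
  have de (c x : R) : is_derive x 1 (e c) (e c x * c).
    by apply: is_derive_scaled_arg; exact: is_derive_expR.
  exists ((2 * k)^-1 *: (e k - e (- k))), (2^-1 *: (e k + e (- k))).
  have e0 c : e c 0 = 1 by rewrite /e mulr0 expR0.
  split=> [||x|x].
  + by rewrite -[LHS]/((2 * k)^-1 * (e k 0 - e (- k) 0)) !e0 subrr mulr0.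
  + by rewrite -[LHS]/(2^-1 * (e k 0 + e (- k) 0)) !e0; field.
  + by apply: is_derive_eq;
      rewrite -[RHS]/(2^-1 * (e k x + e (- k) x)) /GRing.scale /=; field.
  + by apply: is_derive_eq;
      rewrite gammaE -[RHS]/(k ^+ 2 * ((2 * k)^-1 * (e k x - e (- k) x)));
      rewrite /GRing.scale /=; field.
- exists id, (cst 1); split=> // x; first exact: is_derive_id.
  by rewrite mul0r; exact: is_derive_cst.
Qed.

Lemma solves_derive (R : realType) (I : set R) (gamma : R) (F : R -> R) :
  solves I gamma F -> forall x : R, I x ->
    is_derive x 1 F (derive1 F x) /\
    is_derive x 1 (derive1 F) (gamma * F x).
Proof.
move=> solF x Ix; have [dF ddF <-] := solF x Ix.
by split; rewrite derive1E; apply: derivableP.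
Qed.

Lemma is_derive_shift (R : realType) (F : R -> R) (c x dF : R) :
  is_derive (x - c) 1 F dF -> is_derive x 1 (fun r => F (r - c)) dF.
Proof.
move=> dFxc; rewrite -[dF]mulr1; suff dc : is_derive x 1 (fun r => r - c) 1.
  exact: (@is_derive1_comp _ F (fun r => r - c) _ _ _ dFxc dc).
have -> : (fun r => r - c) = (id \- cst c) by apply/funext.
by apply: is_derive_eq; rewrite subr0.
Qed.

Section InitialValues.
Variables (R : realType) (I : set R) (gamma : R) (S C : R -> R).
Hypothesis itvI : is_interval I.
Hypotheses (S0 : S 0 = 0) (C0 : C 0 = 1).
Hypothesis dS : forall x : R, is_derive x 1 S (C x).
Hypothesis dC : forall x : R, is_derive x 1 C (gamma * S x).

(** The derivative of the left-hand side is 2 gamma C S - 2 gamma S C. *)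
Lemma pythagorean_identity x : C x ^+ 2 - gamma * S x ^+ 2 = 1.
Proof.
pose P r := C r * C r - gamma * (S r * S r).
suff : P x = P 0 by rewrite /P S0 C0 -!expr2 => ->; ring.
apply: is_derive_0_is_cst => r.
have -> : P = (C * C - gamma *: (S * S)) by apply/funext.
by apply: is_derive_eq; rewrite /GRing.scale /=; ring.
Qed.

(** The two combinations F C - F' S and F' C - gamma F S, with S and C taken at
    x - c, have derivative zero, so they keep their values F(c) and F'(c) at c;
    solving this linear system for F(x) is possible because its determinant
    C^2 - gamma S^2 is 1.  This also replaces a uniqueness theorem for the
    equation. *)
Lemma solves_from_initial_values (F : R -> R) (c x : R) :
  solves I gamma F -> I c -> I x ->
  F x = F c * C (x - c) + derive1 F c * S (x - c).
Proof.
move=> /solves_derive solF Ic Ix.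
pose Cc r := C (r - c); pose Sc r := S (r - c).
have dCc (r : R) : is_derive r 1 Cc (gamma * Sc r) by exact: is_derive_shift.
have dSc (r : R) : is_derive r 1 Sc (Cc r) by exact: is_derive_shift.
have valE : F x * Cc x - derive1 F x * Sc x = F c.
  have -> : F c = F c * Cc c - derive1 F c * Sc c.
    by rewrite /Cc /Sc subrr S0 C0; ring.
  apply: (zero_derive_constant_on (F := F * Cc - derive1 F * Sc) itvI) => // r Ir.
  have [dF ddF] := solF r Ir.
  by apply: is_derive_eq; rewrite /GRing.scale /=; ring.
have derE : derive1 F x * Cc x - gamma * (F x * Sc x) = derive1 F c.
  have -> : derive1 F c = derive1 F c * Cc c - gamma * (F c * Sc c).
    by rewrite /Cc /Sc subrr S0 C0; ring.
  apply: (zero_derive_constant_on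
    (F := derive1 F * Cc - gamma *: (F * Sc)) itvI) => // r Ir.
  have [dF ddF] := solF r Ir.
  by apply: is_derive_eq; rewrite /GRing.scale /=; ring.
rewrite -[LHS]mulr1 -(pythagorean_identity (x - c)) -valE -derE /Cc /Sc; ring.
Qed.

End InitialValues.

Definition wronskian (R : realType) (u v : R -> R) (x : R) : R :=
  derive1 u x * v x - u x * derive1 v x.

Section Quotient.
Variables (R : realType) (I : set R) (gamma : R) (u v f : R -> R).
Hypothesis openI : open_interval I.
Hypotheses (solu : solves I gamma u) (solv : solves I gamma v).
Hypothesis v_gt0 : forall x, I x -> 0 < v x.
Hypothesis indep : lin_indep_on I u v.
Hypothesis fE : forall x, I x -> f x = u x / v x.

Lemma wronskian_constant x y : I x -> I y -> wronskian u v x = wronskian u v y.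
Proof.
have [itvI _ _] := openI; apply: zero_derive_constant_on => // r Ir.
have [du ddu] := solves_derive solu Ir.
have [dv ddv] := solves_derive solv Ir.
have -> : wronskian u v = derive1 u * v - u * derive1 v by apply/funext.
by apply: is_derive_eq; rewrite /GRing.scale /=; ring.
Qed.

Lemma quotient_is_derive (x : R) :
  I x -> is_derive x 1 f (wronskian u v x / v x ^+ 2).
Proof.
move=> Ix; have [_ opI _] := openI.
have [du _] := solves_derive solu Ix.
have [dv _] := solves_derive solv Ix.
have vx0 : v x != 0 by rewrite gt_eqF ?v_gt0.
apply: (@near_eq_is_derive _ _ _ (u * (fun r => (v r)^-1))).
  by near=> r; rewrite fE //; near: r; exact: open_nbhs_nbhs.
have dvV := is_deriveV vx0 dv.
apply: is_derive_eq; rewrite /GRing.scale /= /wronskian; field; exact: vx0.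
Unshelve. all: by end_near.
Qed.

(** If the constant Wronskian vanished, f' would be zero, hence f constant
    and u a multiple of v. *)
Lemma wronskian_neq0 x : I x -> wronskian u v x != 0.
Proof.
move=> Ix; apply/eqP => W0; have [itvI _ _] := openI.
have fcst r : I r -> f r = f x.
  move=> Ir; apply: (zero_derive_constant_on itvI _ Ir Ix) => s Is.
  have := quotient_is_derive Is.
  by rewrite (wronskian_constant Is Ix) W0 mul0r.
have [|/eqP + _] := @indep 1 (- f x); last by rewrite oner_eq0.
move=> r Ir; have vr0 : v r != 0 by rewrite gt_eqF ?v_gt0.
by rewrite -(fcst r Ir) fE //; field.
Qed.

Lemma quotient_continuous : {within I, continuous f}.
Proof. exact: is_derive_continuous_on quotient_is_derive. Qed.

Lemma quotient_strictly_monotone : strictly_monotone_on I f.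
Proof.
have [itvI _ [c Ic]] := openI.
apply: (signed_derive_strictly_monotone_on itvI quotient_is_derive).
have v2_gt0 r : I r -> 0 < (v r ^+ 2)^-1.
  by move=> Ir; rewrite invr_gt0 exprn_gt0 ?v_gt0.
have := wronskian_neq0 Ic; rewrite neq_lt => /orP[W_lt0|W_gt0]; [right|left] =>
  r Ir; rewrite (wronskian_constant Ir Ic).
- by rewrite pmulr_llt0 ?v2_gt0.
- by rewrite mulr_gt0 ?v2_gt0.
Qed.

(** Expanding u(x) and v(x) around t cancels the C terms in
    u(x) v(t) - u(t) v(x) and leaves W S(x - t): up to the factors v(x) and v(t)
    in the denominator, increments of f depend on x - t only. *)
Lemma quotient_increment (S C : R -> R) :
  S 0 = 0 -> C 0 = 1 ->
  (forall x : R, is_derive x 1 S (C x)) ->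
  (forall x : R, is_derive x 1 C (gamma * S x)) ->
  exists2 W : R, W != 0 &
    forall x t, I x -> I t -> f x - f t = W * S (x - t) / (v x * v t).
Proof.
move=> S0 C0 dS dC; have [itvI _ [c Ic]] := openI.
exists (wronskian u v c); first exact: wronskian_neq0.
move=> x t Ix It; rewrite (wronskian_constant Ic It) !fE //.
have vt0 : v t != 0 by rewrite gt_eqF ?v_gt0.
have vx0 : v x != 0 by rewrite gt_eqF ?v_gt0.
have init F := @solves_from_initial_values _ _ _ _ _ itvI S0 C0 dS dC F t x.
have -> : u x / v x - u t / v t = (u x * v t - u t * v x) / (v x * v t).
  by field; rewrite vt0 vx0.
by rewrite (init u) // {1}(init v) // /wronskian; congr (_ / _); ring.
Qed.

End Quotient.

(** * Bajraktarevic means *)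

Lemma strictly_monotone_on_inj (R : realType) (I : set R) (f : R -> R) :
  strictly_monotone_on I f -> {in I &, injective f}.
Proof.
move=> monof x y xI yI fxy; case: (ltgtP x y) => // xy; case: monof => mono.
- by have := mono x y xI yI xy; rewrite fxy ltxx.
- by have := mono y x yI xI xy; rewrite fxy ltxx.
- by have := mono y x yI xI xy; rewrite fxy ltxx.
- by have := mono x y xI yI xy; rewrite fxy ltxx.
Qed.

(** This characterization avoids the inverse of f: that t is the mean becomes
    an equation which is linear in the increments of f. *)
Lemma bajraktarevic_eq (R : realType) (I : set R) (f p1 p2 : R -> R) (x y t : R) :
  {in I &, injective f} -> I t -> p1 x + p2 y != 0 ->
  p1 x * (f x - f t) + p2 y * (f y - f t) = 0 ->
  bajraktarevic I f p1 p2 x y = t.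
Proof.
move=> injf It p0 eqt; rewrite /bajraktarevic.
have -> : (p1 x * f x + p2 y * f y) / (p1 x + p2 y) = f t.
  apply: (mulIf p0); rewrite divfK //; apply/eqP; rewrite -subr_eq0 -eqt.
  by apply/eqP; ring.
by apply: pinvKV => //; apply: mem_set.
Qed.

(** The weighted mean of f(x) and f(y) is attained between x and y; the
    reflection x + y - t of such a point t lies between x and y as well. *)
Lemma balance_point_exists (R : realType) (I : set R) (f : R -> R)
    (a b x y : R) :
  is_interval I -> {within I, continuous f} -> 0 < a -> 0 < b -> I x -> I y ->
  exists t, [/\ I t, I (x + y - t) & a * (f x - f t) + b * (f y - f t) = 0].
Proof.
move=> itvI cf; wlog xy : x y a b / x <= y.
  move=> wl a0 b0 Ix Iy; case: (leP x y) => [xy|/ltW yx]; first exact: wl.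
  have [t [It Iyxt eqt]] := wl y x b a yx b0 a0 Iy Ix.
  by exists t; rewrite addrC [x + y]addrC (addrC (- t)) (addrC (a * _)).
move=> a0 b0 Ix Iy.
have ab0 : 0 < a + b by rewrite addr_gt0.
have sub : `[x, y] `<=` I.
  by move=> r /=; rewrite in_itv => /=; apply: itvI.
have [||t] := IVT (f := f) (v := (a * f x + b * f y) / (a + b)) xy.
- exact: continuous_subspaceW cf.
- rewrite ler_pdivlMr // ler_pdivrMr // !mulrDr.
  by case: (leP (f x) (f y)) => fxy; apply/andP; split; nra.
rewrite in_itv /= => /andP[xt ty] ft; exists t; split.
- by apply: (itvI x y) => //; rewrite xt ty.
- by apply: (itvI x y) => //; lra.
- by rewrite ft; field; rewrite gt_eqF.
Qed.

(** * The invariance equation *)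

Theorem theorem4 (R : realType) (I : set R) (gamma : R)
    (u v w z f g p1 p2 q1 q2 : R -> R) :
  open_interval I ->
  solves I gamma u -> solves I gamma v ->
  solves I gamma w -> solves I gamma z ->
  (forall x, I x -> 0 < v x) -> (forall x, I x -> 0 < z x) ->
  lin_indep_on I u v -> lin_indep_on I w z ->
  (forall x, I x -> 0 < p1 x) -> (forall x, I x -> 0 < p2 x) ->
  (forall x, I x -> 0 < q1 x) -> (forall x, I x -> 0 < q2 x) ->
  (forall x, I x -> f x = u x / v x) ->
  (forall x, I x -> g x = w x / z x) ->
  (forall x, I x -> p1 x * q1 x = v x * z x) ->
  (forall x, I x -> p2 x * q2 x = v x * z x) ->
  [/\ strictly_monotone_on I f, {within I, continuous f},
      strictly_monotone_on I g, {within I, continuous g} &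
      forall x y, I x -> I y ->
        bajraktarevic I f p1 p2 x y + bajraktarevic I g q1 q2 x y = x + y].
Proof.
move=> openI solu solv solw solz v0 z0 uv wz p10 p20 q10 q20 fE gE pq1 pq2.
have monof := quotient_strictly_monotone openI solu solv v0 uv fE.
have contf := quotient_continuous openI solu solv v0 fE.
have monog := quotient_strictly_monotone openI solw solz z0 wz gE.
have contg := quotient_continuous openI solw solz z0 gE.
split=> // x y Ix Iy; have [itvI _ _] := openI.
have [S [C [S0 C0 dS dC]]] := sine_like_solution gamma.
have [Wf Wf0 incf] :=
  quotient_increment openI solu solv v0 uv fE S0 C0 dS dC.
have [Wg _ incg] :=
  quotient_increment openI solw solz z0 wz gE S0 C0 dS dC.
have [t [It Is ft]] := balance_point_exists itvI contf (p10 x Ix)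
  (p20 y Iy) Ix Iy.
set s := x + y - t in Is.
rewrite (bajraktarevic_eq (t := t)) //; last 2 first.
- exact: strictly_monotone_on_inj.
- by rewrite gt_eqF ?addr_gt0 ?p10 ?p20.
rewrite (bajraktarevic_eq (t := s)) //; first by rewrite /s; ring.
- exact: strictly_monotone_on_inj.
- by rewrite gt_eqF ?addr_gt0 ?q10 ?q20.
(* It remains to check that s balances g x and g y with weights q1 x, q2 y. *)
have ne0 (h : R -> R) r : (forall r, I r -> 0 < h r) -> I r -> h r != 0.
  by move=> h0 Ir; rewrite gt_eqF ?h0.
have q1E : q1 x = v x * z x / p1 x by rewrite -pq1 // mulrAC mulfV ?mul1r ?ne0.
have q2E : q2 y = v y * z y / p2 y by rewrite -pq2 // mulrAC mulfV ?mul1r ?ne0.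
have xs : x - s = t - y by rewrite /s; ring.
have sy : s - y = x - t by rewrite /s; ring.
have ftE : p1 x / v x * S (x - t) = p2 y / v y * S (t - y).
  move: ft; rewrite -(opprB (f t) (f y)) (incf x t) // (incf t y) // => ft.
  have Wv0 : Wf / v t != 0 by rewrite mulf_neq0 ?invr_eq0 ?ne0.
  by apply: (mulfI Wv0); apply/eqP; rewrite -subr_eq0 -[X in _ == X]ft; apply/eqP;
    field; rewrite !ne0.
rewrite -(opprB (g s) (g y)) (incg x s) // (incg s y) // xs sy q1E q2E.
have -> : S (t - y) = p1 x / v x * S (x - t) * (v y / p2 y).
  by rewrite ftE; field; rewrite !ne0.
by field; rewrite !ne0.
Qed.
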